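(* Let $q=e^\tau$ be not a root of unity. Let $a\in\mathbf C$ be such that the representations $T_{a\epsilon}$ of $U_q(\mathrm{sl}_2)$ with $\epsilon=\pm\frac{\mathrm i\pi}{2\tau}+\frac12$ are irreducible, and put $a'=a+\frac{\mathrm i\pi}{2\tau}+\frac12$. The four representations $R^{(\mathrm i,\pm)}_{a'}$, $R^{(-\mathrm i,\pm)}_{a'}$ of $U_q(\mathrm{so}_3)$ are irreducible and pairwise nonequivalent. Any irreducible representation of the form $R_{b\epsilon}$, $b\in\mathbf C$, is not equivalent to any of these representations.
   Context: $q=e^\tau\in\mathbf C$ (so $q^x=e^{\tau x}$ for $x\in\mathbf C$); $\mathrm i=\sqrt{-1}$; $[x]=\frac{q^x-q^{-x}}{q-q^{-1}}$. $U_q(\mathrm{so}_3)$ is the unital associative complex algebra generated by $I_1,I_2,I_3$ with defining relations $q^{1/2}I_1I_2-q^{-1/2}I_2I_1=I_3$, $q^{1/2}I_2I_3-q^{-1/2}I_3I_2=I_1$, $q^{1/2}I_3I_1-q^{-1/2}I_1I_3=I_2$. A representation $R$ is determined by $R(I_1),R(I_2)$, since $R(I_3)=q^{1/2}R(I_1)R(I_2)-q^{-1/2}R(I_2)R(I_1)$. Infinite dimensional representations act on a Hilbert space and are defined on an everywhere dense invariant subspace, here the linear span of the given orthonormal basis (on which $I_1$, respectively $q^H$, is diagonal); irreducibility is understood on this span. Two representations on spaces $\mathcal H,\mathcal H'$ are equivalent if there are everywhere dense invariant subspaces $V\subset\mathcal H$, $V'\subset\mathcal H'$ and a one-to-one linear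 operator $A:V\to V'$ (onto $V'$) intertwining the actions. For $a,\epsilon\in\mathbf C$, $T_{a\epsilon}$ is the representation of $U_q(\mathrm{sl}_2)$ (generators $q^{\pm H},E,F$; $q^HEq^{-H}=qE$, $q^HFq^{-H}=q^{-1}F$, $EF-FE=\frac{q^{2H}-q^{-2H}}{q-q^{-1}}$) on the Hilbert space with orthonormal basis $|m\rangle$, $m=n+\epsilon$, $n\in\mathbf Z$, given by $T_{a\epsilon}(q^H)|m\rangle=q^m|m\rangle$, $T_{a\epsilon}(E)|m\rangle=[a-m]|m+1\rangle$, $T_{a\epsilon}(F)|m\rangle=[a+m]|m-1\rangle$. For $b\in\mathbf C$ and $0\le\mathrm{Re}\,\epsilon<1$ with $\epsilon\ne\pm\frac{\mathrm i\pi}{2\tau}$, $\epsilon\neq\pm\frac{\mathrm i\pi}{2\tau}+\frac12$, the representation $R_{b\epsilon}$ of $U_q(\mathrm{so}_3)$ acts on the same space by $R_{b\epsilon}(I_1)|m\rangle=\mathrm i[m]|m\rangle$, $R_{b\epsilon}(I_2)|m\rangle=\frac{1}{q^m+q^{-m}}\{[b-m]|m+1\rangle-[b+m]|m-1\rangle\}$. The representations $R^{(\pm\mathrm i,\pm)}_{a'}$ act on the Hilbert space with orthonormal basis $|k\rangle$, $k=1,2,3,\dots$, by $$R^{(\mathrm i,\pm)}_{a'}(I_1)|k\rangle=-\frac{q^{k-1/2}+q^{-k+1/2}}{q-q^{-1}}|k\rangle,$$ $$R^{(\mathrm i,\pm)}_{a'}(I_2)|1\rangle=\pm\frac{[a']}{q^{1/2}-q^{-1/2}}|1\rangle+\mathrm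 i\frac{[a'-1]}{q^{1/2}-q^{-1/2}}|2\rangle,$$ $$R^{(\mathrm i,\pm)}_{a'}(I_2)|k\rangle=\mathrm i\frac{[a'-k]}{q^{k-1/2}-q^{-k+1/2}}|k+1\rangle+\mathrm i\frac{[a'+k-1]}{q^{k-1/2}-q^{-k+1/2}}|k-1\rangle,\quad k\neq1,$$ and $R^{(-\mathrm i,\pm)}_{a'}(I_1)=-R^{(\mathrm i,\pm)}_{a'}(I_1)$, $R^{(-\mathrm i,\pm)}_{a'}(I_2)=-R^{(\mathrm i,\pm)}_{a'}(I_2)$. *)

(* Defs.v *)
From HB Require Import structures.
From mathcomp Require Import all_boot all_order all_algebra.
From mathcomp Require Export complex.
From mathcomp Require Import all_classical all_reals all_analysis.

Set Implicit Arguments.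
Unset Strict Implicit.
Unset Printing Implicit Defensive.

Import Order.TTheory GRing.Theory Num.Theory.
Local Open Scope classical_set_scope.
Local Open Scope ring_scope.
Local Open Scope complex_scope.

Section QNumbers.
Variable R : realType.
Implicit Types z tau x : R[i].

Definition cexp z : R[i] :=
  (expR (complex.Re z))%:C * (cos (complex.Im z) +i* sin (complex.Im z)).

(** The parameter [tau] is kept throughout: [q = cexp tau], and [q^x] depends
    on the choice of [tau], not on [q] alone. *)
Definition qpow tau x : R[i] := cexp (tau * x).

Definition qnum tau x : R[i] :=
  (qpow tau x - qpow tau (- x)) / (qpow tau 1 - qpow tau (- 1)).

Definition ipi2tau tau : R[i] := 'i * (pi : R)%:C / (2 * tau).

End QNumbers.

(** The Hilbert space with an orthonormal basis indexed by [I] is modelled by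
    the square-summable families [ell2] inside all functions [I -> R[i]].
    Operators are total functions, but only their values on [kspan], the linear
    span of the basis, are ever used. *)
Section HilbertSpace.
Variables (R : realType) (I : choiceType).

Definition hvec : lmodType R[i] := (I -> R[i]^o).

Definition ket (i : I) : hvec := fun j => (j == i)%:R.

Definition ell2 : set hvec :=
  [set f | (\esum_(i in [set: I]) ((complex.Re `|f i : R[i]|) ^+ 2)%:E < +oo)%E].

Definition kspan : set hvec :=
  [set f | exists (s : seq I) (c : I -> R[i]), f = \sum_(i <- s) c i *: ket i].

Definition dense_in_ell2 (V : set hvec) : Prop :=
  forall f, ell2 f -> forall e : R, 0 < e ->
    exists2 v, V v &
      (\esum_(i in [set: I]) ((complex.Re `|(f i : R[i]) - v i|) ^+ 2)%:E < e%:E)%E.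

Definition subspace_of_span (W : set hvec) : Prop :=
  [/\ W `<=` kspan, W 0 &
      forall (c : R[i]) f g, W f -> W g -> W (c *: f + g)].

(** The linear extension to [kspan] of [ket i |-> col i]; the sum is finite for
    finitely supported [f]. *)
Definition lin_ext (col : I -> hvec) : hvec -> hvec :=
  fun f => \sum_(i \in [set: I]) (f i : R[i]) *: col i.

Definition span_operator (A : hvec -> hvec) : Prop :=
  (forall f, kspan f -> kspan (A f)) /\
  (forall (c : R[i]) f g, kspan f -> kspan g -> A (c *: f + g) = c *: A f + A g).

End HilbertSpace.

(** An action of an algebra given by generators [G] is a family of operators
    indexed by [G]. *)
Section Actions.
Variables (R : realType) (G : Type).

Definition action (I : choiceType) := G -> hvec R I -> hvec R I.

Definition invariant_subspace (I : choiceType) (rho : action I)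
    (W : set (hvec R I)) : Prop :=
  subspace_of_span W /\ forall g f, W f -> W (rho g f).

Definition irreducible (I : choiceType) (rho : action I) : Prop :=
  @kspan R I <> [set 0] /\
  forall W, invariant_subspace rho W -> W = [set 0] \/ W = @kspan R I.

(** The dense invariant subspaces lie in [kspan], the common domain of the
    operators; they are dense in the Hilbert space [ell2]. *)
Definition equivalent (I J : choiceType) (rho : action I) (sigma : action J)
    : Prop :=
  exists (V : set (hvec R I)) (V' : set (hvec R J)) (A : hvec R I -> hvec R J),
  [/\ invariant_subspace rho V /\ dense_in_ell2 V,
      invariant_subspace sigma V' /\ dense_in_ell2 V',
      forall (c : R[i]) f g, V f -> V g -> A (c *: f + g) = c *: A f + A g,
      set_bij V V' A
    & forall g f, V f -> A (rho g f) = sigma g (A f)].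

End Actions.

Inductive so3_gen := so3_I1 | so3_I2 | so3_I3.
Inductive sl2_gen := sl2_qH | sl2_qHinv | sl2_E | sl2_F.

Section Representations.
Variables (R : realType) (tau : R[i]).

Definition so3_rep (I : choiceType) (rho : action R so3_gen I) : Prop :=
  let I1 := rho so3_I1 in let I2 := rho so3_I2 in let I3 := rho so3_I3 in
  let qh := qpow tau (1/2) in let qmh := qpow tau (- (1/2)) in
  (forall g, span_operator (rho g)) /\
  (forall f, kspan f ->
    [/\ qh *: I1 (I2 f) - qmh *: I2 (I1 f) = I3 f,
        qh *: I2 (I3 f) - qmh *: I3 (I2 f) = I1 f
      & qh *: I3 (I1 f) - qmh *: I1 (I3 f) = I2 f]).

Definition so3_irrep (I : choiceType) (rho : action R so3_gen I) : Prop :=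
  so3_rep rho /\ irreducible rho.

Definition so3_action (I : choiceType) (A1 A2 : hvec R I -> hvec R I)
    : action R so3_gen I := fun g =>
  match g with
  | so3_I1 => A1
  | so3_I2 => A2
  | so3_I3 => fun f =>
      qpow tau (1/2) *: A1 (A2 f) - qpow tau (- (1/2)) *: A2 (A1 f)
  end.

Definition sl2_rep (I : choiceType) (rho : action R sl2_gen I) : Prop :=
  let K := rho sl2_qH in let K' := rho sl2_qHinv in
  let E := rho sl2_E in let F := rho sl2_F in
  let q := qpow tau 1 in let q' := qpow tau (- 1) in
  (forall g, span_operator (rho g)) /\
  (forall f, kspan f ->
    [/\ K (K' f) = f /\ K' (K f) = f,
        K (E (K' f)) = q *: E f,
        K (F (K' f)) = q' *: F f
      & E (F f) - F (E f) = (q - q')^-1 *: (K (K f) - K' (K' f))]).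

Definition sl2_irrep (I : choiceType) (rho : action R sl2_gen I) : Prop :=
  sl2_rep rho /\ irreducible rho.

(** [ket n] stands for [|m>] with [m = n + eps], [n] in [int]. *)
Definition T_rep (a eps : R[i]) : action R sl2_gen int := fun g =>
  lin_ext (fun n : int => let m := n%:~R + eps in
    match g with
    | sl2_qH    => qpow tau m *: ket R n
    | sl2_qHinv => qpow tau (- m) *: ket R n
    | sl2_E     => qnum tau (a - m) *: ket R (n + 1)
    | sl2_F     => qnum tau (a + m) *: ket R (n - 1)
    end).

Definition Rb_rep (b eps : R[i]) : action R so3_gen int :=
  so3_action
    (lin_ext (fun n : int => let m := n%:~R + eps in
       ('i * qnum tau m) *: ket R n))
    (lin_ext (fun n : int => let m := n%:~R + eps in
       (qpow tau m + qpow tau (- m))^-1 *: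
         (qnum tau (b - m) *: ket R (n + 1) - qnum tau (b + m) *: ket R (n - 1)))).

(** The basis vectors [|k>], [k = 1, 2, ...], are [ketp k]. *)
Definition ketp (k : nat) : hvec R nat := ket R k.-1.

(** [Rh_rep false t a'] is [R^(i,+-)_a'] and [Rh_rep true t a'] is
    [R^(-i,+-)_a'], where [+-] is the sign [(-1) ^+ t]. *)
Definition Rh_rep (s t : bool) (a' : R[i]) : action R so3_gen nat :=
  let sgn (u : bool) : R[i] := (-1) ^+ u in
  so3_action
    (lin_ext (fun n : nat => let k := n.+1 in
       (sgn s * - ((qpow tau (k%:R - 1/2) + qpow tau (- k%:R + 1/2)) /
                   (qpow tau 1 - qpow tau (- 1)))) *: ketp k))
    (lin_ext (fun n : nat => let k := n.+1 in
       sgn s *: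
       if k == 1%N then
         (sgn t * (qnum tau a' / (qpow tau (1/2) - qpow tau (- (1/2)))))
           *: ketp 1 +
         ('i * (qnum tau (a' - 1) / (qpow tau (1/2) - qpow tau (- (1/2)))))
           *: ketp 2
       else
         ('i * (qnum tau (a' - k%:R) /
                (qpow tau (k%:R - 1/2) - qpow tau (- k%:R + 1/2))))
           *: ketp k.+1 +
         ('i * (qnum tau (a' + k%:R - 1) /
                (qpow tau (k%:R - 1/2) - qpow tau (- k%:R + 1/2))))
           *: ketp k.-1)).

End Representations.

(* Main.v *)
Require Import Defs.
From HB Require Import structures.
From mathcomp Require Import all_boot all_order all_algebra.
From mathcomp Require Import all_classical all_reals all_analysis.
From mathcomp Require Import ring lra zify.

Import Order.TTheory GRing.Theory Num.Theory.
Local Open Scope ring_scope.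
Local Open Scope complex_scope.

Set Implicit Arguments.
Unset Strict Implicit.
Unset Printing Implicit Defensive.

(** The operator I1 is diagonal in each of the representations involved, so
    everything is read off from its eigenvalues and from the matrix entries of
    I2. In [Rh_rep] the eigenvalues of I1 are, up to the sign [s] and the factor
    [- (q - q^-1)^-1], the numbers [x + x^-1] with [x = q^(k - 1/2)], [k >= 1].
    As [q] is not a root of unity, they are pairwise distinct, and no sum of two
    of them vanishes ([ladder_eig_sign_inj]).

    Irreducibility: an invariant subspace of a diagonal operator with simple
    spectrum contains every basis vector on which one of its elements has a
    nonzero coordinate ([invariant_ket]), and I2 links [|k>] to [|k + 1>] and
    [|k - 1>] with coefficients proportional to [a' + n] for integers [n]. If one
    of these q-numbers vanished, a lowering coefficient of the representation
    of U_q(sl_2) would vanish as well and cut off a proper invariant subspace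
    ([T_rep_irreducible_qnum]).

    Defining relations: the formulas that give I1 and I2 on [|k>] for [k >= 2]
    make sense for all integers [k], and they are invariant under the reflection
    [k |-> 1 - k] up to signs. Identifying [|1 - k>] with a suitable multiple of
    [|k>] turns the exceptional formula for [|1>] into the generic one, the
    identification of [|0>] producing the diagonal term of I2. Hence the
    relations have to be checked only on the generic vector of a ladder indexed
    by the integers ([Rh_I1_fold], [Rh_I2_fold]), where they reduce to identities
    between the coefficients.

    Nonequivalence: a dense invariant subspace is nonzero, so for irreducible
    representations it is the whole span, and an equivalence is an injective
    intertwining operator on it ([irreducible_equivalent]). Such an operator
    maps eigenvectors of I1 to eigenvectors with the same eigenvalue. This
    separates the two values of [s]. For equal [s] it is diagonal, so it
    preserves the diagonal entry of I2 at [|1>], whose sign is given by [t]. In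
    [Rb_rep] the eigenvalues are [(z + z^-1) / (q - q^-1)] with
    [z = i q^(n + eps)]; if one of them also is an eigenvalue in [Rh_rep], then
    [z ^ 2 = q ^ M] with [M] odd, and the basis vector at distance [- M] has
    [z^-1] in place of [z]. So the eigenvalue is at least double, whereas the
    spectrum in [Rh_rep] is simple ([intertwiner_injective]). *)

(** * Linear algebra on the span of the basis *)

Section Span.
Variables (R : realType) (I : choiceType).
Implicit Types (i j : I) (f g : hvec R I) (col : I -> hvec R I) (c : R[i]).

Lemma ketE i j : ket R i j = (j == i)%:R.
Proof. by []. Qed.

Lemma hvecDE f g i : (f + g) i = f i + g i.
Proof. by []. Qed.

Lemma hvecZE c f i : (c *: f) i = c * (f i : R[i]).
Proof. by []. Qed.

Lemma kspan_ket i : kspan (ket R i).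
Proof. by exists [:: i], (fun=> 1); rewrite big_seq1 scale1r. Qed.

Lemma kspan0 : @kspan R I 0.
Proof. by exists [::], (fun=> 0); rewrite big_nil. Qed.

Lemma ket_coefE (s : seq I) (c : I -> R[i]) j :
  (\sum_(i <- s) c i *: ket R i) j = c j *+ count_mem j s.
Proof.
elim: s => [|i s IHs]; first by rewrite big_nil.
rewrite big_cons hvecDE hvecZE ketE IHs /= eq_sym mulrnDr; congr (_ + _).
by case: eqP => [->|_]; rewrite ?mulr1 ?mulr0.
Qed.

(** In terms of supports, closure under linear combinations only requires
    concatenating two lists of indices. *)
Lemma kspanP f :
  kspan f <-> exists s : seq I, forall i, i \notin s -> f i = 0.
Proof.
split=> [[s [c ->]]|[s fs]].
  by exists s => i /count_memPn si; rewrite ket_coefE si mulr0n.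
exists (undup s), f; apply/funext => j; rewrite ket_coefE.
rewrite count_uniq_mem ?undup_uniq// mem_undup.
by case: (boolP (j \in s)) => // /fs ->; rewrite mul0rn.
Qed.

Lemma kspan_lin c f g : kspan f -> kspan g -> kspan (c *: f + g).
Proof.
move=> /kspanP[s fs] /kspanP[t gt]; apply/kspanP; exists (s ++ t) => i.
by rewrite mem_cat negb_or hvecDE hvecZE => /andP[/fs -> /gt ->]; rewrite mulr0 addr0.
Qed.

Lemma kspanD f g : kspan f -> kspan g -> kspan (f + g).
Proof. by move=> fs gs; rewrite -[f]scale1r; exact: kspan_lin. Qed.

Lemma kspanZ c f : kspan f -> kspan (c *: f).
Proof.
by move=> fs; rewrite -[X in kspan X]addr0; apply: kspan_lin => //; exact: kspan0.
Qed.

Lemma kspan_sum (J : Type) (s : seq J) (F : J -> hvec R I) :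
  (forall k, kspan (F k)) -> kspan (\sum_(k <- s) F k).
Proof.
by move=> Fs; apply: big_ind => // [|f g]; [exact: kspan0|exact: kspanD].
Qed.

Lemma subspace_kspan (W : set (hvec R I)) :
  subspace_of_span W -> (forall i, W (ket R i)) -> W = @kspan R I.
Proof.
move=> [Wk W0 Wlin] Wket; apply/seteqP; split=> // _ [s [c ->]].
by elim: s => [|i s IHs]; rewrite ?big_nil// big_cons; exact: Wlin.
Qed.

Lemma lin_ext_supp col f (s : seq I) :
  uniq s -> (forall i, i \notin s -> f i = 0) ->
  lin_ext col f = \sum_(i <- s) (f i : R[i]) *: col i.
Proof.
move=> us fs; rewrite /lin_ext (fsbigE s)//; last first.
  by move=> i _ /fs ->; rewrite scale0r.
by apply: eq_bigl => i; rewrite in_setT.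
Qed.

Lemma lin_ext_lin col c f g :
  kspan f -> kspan g ->
  lin_ext col (c *: f + g) = c *: lin_ext col f + lin_ext col g.
Proof.
move=> /kspanP[s fs] /kspanP[t gt].
have us := undup_uniq (s ++ t).
have fgs : forall i, i \notin undup (s ++ t) -> f i = 0 /\ g i = 0.
  by move=> i; rewrite mem_undup mem_cat negb_or => /andP[/fs -> /gt ->].
rewrite !(lin_ext_supp col us); first 1 last; try by move=> i /fgs[fi gi];
  rewrite ?hvecDE ?hvecZE ?fi ?gi ?mulr0 ?addr0.
rewrite scaler_sumr -big_split; apply: eq_bigr => i _ /=.
by rewrite hvecDE hvecZE scalerDl scalerA.
Qed.

Lemma lin_ext_ket col i : lin_ext col (ket R i) = col i.
Proof.
rewrite (@lin_ext_supp col _ [:: i])// ?big_seq1 ?ketE ?eqxx ?scale1r//.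
by move=> j; rewrite inE => /negPf ji; rewrite ketE ji.
Qed.

Lemma lin_ext_span col : (forall i, kspan (col i)) -> span_operator (lin_ext col).
Proof.
move=> cols; split=> [f /kspanP[s fs]|c f g]; last exact: lin_ext_lin.
rewrite (@lin_ext_supp col f (undup s)) ?undup_uniq//.
  by apply: kspan_sum => i; exact: kspanZ.
by move=> i; rewrite mem_undup => /fs.
Qed.

End Span.

Section SpanLinear.
Variables (R : realType) (I J : choiceType) (A : hvec R I -> hvec R J).
Hypothesis Alin : forall (c : R[i]) f g,
  kspan f -> kspan g -> A (c *: f + g) = c *: A f + A g.

Lemma span_linear0 : A 0 = 0.
Proof.
have := Alin (-1) (@kspan0 R I) (@kspan0 R I).
by rewrite scaler0 addr0 scaleN1r addNr.
Qed.

Lemma span_linearZ c f : kspan f -> A (c *: f) = c *: A f.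
Proof.
by move=> fk; have := Alin c fk (@kspan0 R I); rewrite !addr0 span_linear0 addr0.
Qed.

End SpanLinear.

Section SpanOperators.
Variables (R : realType) (I : choiceType).
Implicit Types (A B : hvec R I -> hvec R I) (f g : hvec R I) (c d : R[i]).

Lemma span_operator_comp A B :
  span_operator A -> span_operator B -> span_operator (A \o B).
Proof.
move=> [Ak Al] [Bk Bl]; split=> [f fk|c f g fk gk] /=; first exact/Ak/Bk.
by rewrite Bl// Al//; exact: Bk.
Qed.

Lemma span_operator_comb A B c d : span_operator A -> span_operator B ->
  span_operator (fun f => c *: A f - d *: B f).
Proof.
move=> [Ak Al] [Bk Bl]; split=> [f fk|e f g fk gk].
  by apply: kspan_lin; [exact: Ak|rewrite -scaleNr; apply/kspanZ/Bk].
apply/funext => j; rewrite Al// Bl// !(hvecDE, hvecZE) -!scaleNr !(hvecDE, hvecZE).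
by ring.
Qed.

Lemma span_operatorZD A c (u v : R[i]) f g : span_operator A ->
  kspan f -> kspan g -> A (c *: (u *: f + v *: g)) = c *: (u *: A f + v *: A g).
Proof.
move=> [_ Al] fk gk.
have vgk : kspan (v *: g) by exact: kspanZ.
by rewrite (span_linearZ Al) ?Al ?(span_linearZ Al)//; exact: kspan_lin.
Qed.

Lemma span_operator_eq A B : span_operator A -> span_operator B ->
  (forall i, A (ket R i) = B (ket R i)) -> forall f, kspan f -> A f = B f.
Proof.
move=> [_ Al] [_ Bl] AB _ [s [c ->]].
elim: s => [|i s IHs].
  by rewrite big_nil (span_linear0 Al) (span_linear0 Bl).
have sk : kspan (\sum_(i <- s) c i *: ket R i) by exists s, c.
have ik := kspan_ket R i.
by rewrite big_cons Al// Bl// AB IHs.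
Qed.

End SpanOperators.

(** * Diagonal operators *)

Section Diagonal.
Variables (R : realType) (I : choiceType).
Implicit Types (i : I) (f g : hvec R I) (lam : I -> R[i]) (W : set (hvec R I)).

Definition diag_op lam : hvec R I -> hvec R I :=
  lin_ext (fun i => lam i *: ket R i).

Lemma diag_opE lam f i :
  kspan f -> diag_op lam f i = lam i * (f i : R[i]).
Proof.
move=> /kspanP[s fs].
have fs' j : j \notin undup s -> f j = 0 by rewrite mem_undup => /fs.
rewrite /diag_op (@lin_ext_supp _ _ _ f (undup s)) ?undup_uniq//.
under eq_bigr do rewrite scalerA.
rewrite ket_coefE count_uniq_mem ?undup_uniq//.
by case: (boolP (i \in _)) => [_|/fs' ->]; rewrite ?mulr1n ?mulr0n ?mulr0// mulrC.
Qed.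

Lemma ket_neq0 i : ket R i <> 0.
Proof.
by move=> /(congr1 (fun f => f i)); rewrite ketE eqxx => /eqP; rewrite oner_eq0.
Qed.

(** Applying the operators [diag_op lam - lam j] one after the other to an
    element of an invariant subspace kills its coordinates other than [i] one
    by one, and only rescales the coordinate [i] by a nonzero factor. *)
Lemma invariant_ket lam W f i :
  injective lam -> subspace_of_span W ->
  (forall g, W g -> W (diag_op lam g)) ->
  W f -> f i <> 0 -> W (ket R i).
Proof.
move=> lam_inj [Wk W0 Wlin] WD Wf fi0.
have WZ c g : W g -> W (c *: g) by move=> Wg; rewrite -[_ *: _]addr0; exact: Wlin.
have [s fs] := (kspanP f).1 (Wk _ Wf).
have kill (t : seq I) : exists g, [/\ W g, g i <> 0,
    forall j, j \in t -> j != i -> g j = 0 & forall j, f j = 0 -> g j = 0].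
  elim: t => [|j t [g [Wg gi gt gf]]]; first by exists f; split.
  (* The coordinate [i] itself is left alone. *)
  have [->|ji] := eqVneq j i.
    by exists g; split=> // k; rewrite inE => /orP[/eqP ->|/gt//]; rewrite eqxx.
  exists (- lam j *: g + diag_op lam g).
  have gE k : (- lam j *: g + diag_op lam g) k = (lam k - lam j) * (g k : R[i]).
    by rewrite hvecDE hvecZE diag_opE ?mulNr; [ring|exact: Wk].
  split.
  - by apply: Wlin => //; exact: WD.
  - rewrite gE => /eqP; rewrite mulf_eq0 subr_eq0 => /orP[/eqP/lam_inj ij|/eqP//].
    by rewrite ij eqxx in ji.
  - move=> k; rewrite inE gE => /orP[/eqP ->|kt ki]; first by rewrite subrr mul0r.
    by rewrite gt//; apply: mulr0.
  - by move=> k fk; rewrite gE gf// mulr0.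
have [g [Wg gi gs gf]] := kill s.
have -> : ket R i = (g i : R[i])^-1 *: g.
  apply/funext => k; rewrite hvecZE ketE; have [->|ki] := eqVneq k i.
    by rewrite mulVf//; apply/eqP.
  have -> : g k = 0 by case: (boolP (k \in s)) => [ks|/fs/gf//]; exact: gs.
  by apply/esym; apply: mulr0.
exact: WZ.
Qed.

Lemma kspan_neq0 (i : I) : @kspan R I <> [set 0]%classic.
Proof. by move=> /seteqP[/(_ _ (kspan_ket R i))/ket_neq0]. Qed.

(** A basis vector lies at distance 1 from 0. *)
Lemma dense_neq0 (i : I) (V : set (hvec R I)) :
  dense_in_ell2 V -> V <> [set 0]%classic.
Proof.
move=> dV V0.
pose a j : \bar R := ((complex.Re `|ket R i j : R[i]|) ^+ 2)%:E.
have a0 j : (0 <= a j)%E by rewrite lee_fin sqr_ge0.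
have aE : \esum_(j in [set: I]) a j = 1%E.
  have -> : \esum_(j in [set: I]) a j = \esum_(j in [set i]%classic) a j.
    rewrite [RHS]esum_mkcond; apply: eq_esum => j _.
    rewrite /a ketE classical_sets.in_set1; case: eqP => _ //.
    by rewrite (_ : false%:R = 0 :> R[i])// normr0 expr0n.
  by rewrite esum_set1// /a ketE eqxx normr1 expr1n.
have ell2k : ell2 (ket R i).
  by rewrite /ell2 /= -/a aE ltry.
have [v] := dV _ ell2k 1 ltr01.
rewrite V0 => -> .
have -> : \esum_(j in [set: I])
    (complex.Re `|(ket R i j : R[i]) - (0 : hvec R I) j| ^+ 2)%:E =
    \esum_(j in [set: I]) a j.
  by apply: eq_esum => j _; rewrite subr0.
by rewrite aE ltxx.
Qed.

End Diagonal.

(** * Intertwining operators *)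

Section Intertwiner.
Variables (R : realType) (G : Type) (I J : choiceType).
Variables (rho : action R G I) (sigma : action R G J).

Definition intertwiner (A : hvec R I -> hvec R J) : Prop :=
  [/\ forall c f g, kspan f -> kspan g -> A (c *: f + g) = c *: A f + A g,
      forall f, kspan f -> kspan (A f),
      forall f, kspan f -> A f = 0 -> f = 0
    & forall g f, kspan f -> A (rho g f) = sigma g (A f)].

(** A dense subspace is nonzero, hence all of [kspan] when it is invariant and
    the representation is irreducible. *)
Lemma irreducible_equivalent (i : I) (j : J) :
  irreducible rho -> irreducible sigma -> equivalent rho sigma ->
  exists A, intertwiner A.
Proof.
move=> [_ irr] [_ irr'] [V [V' [A [[inv dV] [inv' dV'] Alin [AV Ainj _] Aint]]]].
have VE : V = @kspan R I by have [/(dense_neq0 i dV)|] := irr V inv.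
have V'E : V' = @kspan R J by have [/(dense_neq0 j dV')|] := irr' V' inv'.
subst V V'; exists A; split=> //.
move=> f fk Af; apply: Ainj; rewrite ?in_setE//; first exact: kspan0.
by rewrite Af span_linear0.
Qed.

End Intertwiner.

Section SpectrumTransfer.
Variables (R : realType) (G : Type) (I J : choiceType).
Variables (rho : action R G I) (sigma : action R G J) (g0 : G).
Variables (lam : I -> R[i]) (mu : J -> R[i]) (A : hvec R I -> hvec R J).
Hypotheses (rhoE : rho g0 = diag_op lam) (sigmaE : sigma g0 = diag_op mu).
Hypothesis intA : intertwiner rho sigma A.

(** Comparing the coordinates at [j] of [sigma g0 (A (ket R i))] computed in two
    ways: coordinates of an image can only survive inside one eigenspace. *)
Lemma intertwiner_eigen i j : A (ket R i) j <> 0 -> mu j = lam i.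
Proof.
have [Alin Ak _ Aint] := intA.
have ik := kspan_ket R i.
have := Aint g0 _ ik; rewrite rhoE sigmaE {1}/diag_op lin_ext_ket (span_linearZ Alin)//.
move=> /(congr1 (fun f => f j)); rewrite hvecZE (diag_opE _ _ (Ak _ ik)).
by move=> eq_lm Aij; apply: (mulIf (x := A (ket R i) j : R[i])) => //; apply/eqP.
Qed.

Lemma intertwiner_eigenvalue i : exists j, mu j = lam i /\ A (ket R i) j <> 0.
Proof.
have [_ _ Ainj _] := intA.
have [j Aij] : exists j, A (ket R i) j <> 0.
  apply/existsNP => A0; apply: (@ket_neq0 R I i); apply: Ainj; first exact: kspan_ket.
  by apply/funext => j; rewrite A0.
by exists j; split => //; exact: intertwiner_eigen.
Qed.

Lemma intertwiner_ket i j :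
  injective mu -> mu j = lam i -> A (ket R i) = (A (ket R i) j : R[i]) *: ket R j.
Proof.
move=> mu_inj mulam; apply/funext => k; rewrite hvecZE ketE.
have [->|kj] := eqVneq k j; first by rewrite mulr1.
rewrite mulr0; apply: contrapT => /intertwiner_eigen; rewrite -mulam => /mu_inj kj'.
by rewrite kj' eqxx in kj.
Qed.

(** Two basis vectors with the same eigenvalue would be mapped into the same
    one-dimensional eigenspace. *)
Lemma intertwiner_injective : injective mu -> injective lam.
Proof.
move=> mu_inj i i' ii'; have [Alin _ Ainj _] := intA.
have [j [jl Aij]] := intertwiner_eigenvalue i.
have ik := kspan_ket R i; have i'k := kspan_ket R i'.
have Ai := intertwiner_ket mu_inj jl.
have Ai' := intertwiner_ket mu_inj (etrans jl ii').
pose c := A (ket R i) j : R[i]; pose c' := A (ket R i') j : R[i].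
(* [A] maps [ket i] and [ket i'] to the multiples [c] and [c'] of [ket j], so it
   kills this combination. *)
have : - c' *: ket R i + c *: ket R i' = 0.
  apply: Ainj; first by apply: kspan_lin => //; exact: kspanZ.
  rewrite Alin//; last exact: kspanZ.
  by rewrite (span_linearZ Alin)// Ai Ai' !scalerA -scalerDl mulNr mulrC addNr scale0r.
move=> /(congr1 (fun f => f i')); rewrite hvecDE !hvecZE !ketE eqxx mulr1.
have [->//|_] := eqVneq i' i.
by rewrite mulr0 add0r.
Qed.

End SpectrumTransfer.

(** * Powers of q *)

Section QPowers.
Variables (R : realType) (tau : R[i]).
Implicit Types (x y : R[i]).

Lemma cexpD x y : cexp (x + y) = cexp x * cexp y.
Proof.
case: x y => [a b] [c d]; rewrite /cexp /= expRD cosD sinD.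
by apply/eqP; rewrite eq_complex /=; apply/andP; split; apply/eqP; ring.
Qed.

Lemma cexp0 : cexp (0 : R[i]) = 1.
Proof. by rewrite /cexp /= expR0 cos0 sin0 mul1r. Qed.

Lemma qpowD x y : qpow tau (x + y) = qpow tau x * qpow tau y.
Proof. by rewrite /qpow mulrDr cexpD. Qed.

Lemma qpow0 : qpow tau 0 = 1.
Proof. by rewrite /qpow mulr0 cexp0. Qed.

Lemma qpowMN x : qpow tau x * qpow tau (- x) = 1.
Proof. by rewrite -qpowD subrr qpow0. Qed.

Lemma qpow_neq0 x : qpow tau x != 0.
Proof.
apply/eqP => x0; have := qpowMN x.
by rewrite x0 mul0r => /esym/eqP; rewrite oner_eq0.
Qed.

Lemma qpowN x : qpow tau (- x) = (qpow tau x)^-1.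
Proof. by apply: (mulfI (qpow_neq0 x)); rewrite qpowMN divff ?qpow_neq0. Qed.

Lemma qpow_nat n : qpow tau n%:R = cexp tau ^+ n.
Proof.
elim: n => [|n IHn]; first by rewrite qpow0.
by rewrite -natr1 qpowD IHn exprSr /qpow mulr1.
Qed.

Hypothesis q_not_unity_root : forall n : nat, (0 < n)%N -> cexp tau ^+ n != 1.

Lemma qpow_int_eq1 (n : int) : qpow tau n%:~R = 1 -> n = 0.
Proof.
have pos k : qpow tau k%:R = 1 -> k = 0%N.
  case: k => // k; rewrite qpow_nat => qk.
  by have := @q_not_unity_root k.+1 isT; rewrite qk eqxx.
case: n => n; first by move=> /pos ->.
by rewrite NegzE mulrNz qpowN => /(congr1 (@GRing.inv _)); rewrite invrK invr1 => /pos.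
Qed.

Lemma qdiff_neq0 : qpow tau 1 - (qpow tau 1)^-1 != 0.
Proof.
rewrite subr_eq0; apply/eqP => /(congr1 (fun z => qpow tau 1 * z)).
rewrite divff ?qpow_neq0// -qpowD => q2.
by have := @qpow_int_eq1 2; rewrite -[2%:~R]/(1 + 1) => /(_ q2).
Qed.

Lemma qnumE x :
  qnum tau x = (qpow tau x - (qpow tau x)^-1) / (qpow tau 1 - (qpow tau 1)^-1).
Proof. by rewrite /qnum !qpowN. Qed.

End QPowers.

(** * Lowering coefficients of irreducible representations *)

(** A coordinate subspace is stable under a linear extension as soon as the
    columns attached to its basis vectors belong to it. *)
Lemma lin_ext_vanishing (R : realType) (I : choiceType) (col : I -> hvec R I) (P : pred I)
    (f : hvec R I) :
  (forall i, ~~ P i -> kspan (col i) /\ forall j, P j -> col i j = 0) ->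
  kspan f -> (forall j, P j -> f j = 0) ->
  kspan (lin_ext col f) /\ forall j, P j -> lin_ext col f j = 0.
Proof.
move=> colP /kspanP[s fs] fP.
rewrite (@lin_ext_supp _ _ col f (undup s)) ?undup_uniq//; last first.
  by move=> i; rewrite mem_undup => /fs.
elim: (undup s) => [|i r [IHk IHP]].
  by rewrite big_nil; split=> //; exact: kspan0.
rewrite big_cons; have [Pi|/colP[ck cP]] := boolP (P i).
  by rewrite fP// scale0r add0r.
split; first exact: kspan_lin.
by move=> j Pj; rewrite hvecDE hvecZE cP// IHP// addr0 mulr0.
Qed.

Section SL2.
Variables (R : realType) (tau a eps : R[i]).

(** If [qnum (a + m) = 0] for [m = n + eps], the lowering operator kills the
    basis vector with index [n], and those with index at least [n] span a proper
    invariant subspace. *)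
Lemma T_rep_irreducible_qnum (n : int) :
  irreducible (T_rep tau a eps) -> qnum tau (a + (n%:~R + eps)) != 0.
Proof.
move=> [_ irr]; apply/eqP => an0.
pose W : set (hvec R int) :=
  [set f | kspan f /\ forall j : int, j < n -> f j = 0]%classic.
have ketW m : n <= m -> W (ket R m).
  move=> nm; split=> [|j jn]; first exact: kspan_ket.
  by rewrite ketE; case: eqP => // jm; move: jn; rewrite jm ltNge nm.
have WZ c f : W f -> W (c *: f).
  by move=> [fk fn]; split=> [|j jn]; [exact: kspanZ|rewrite hvecZE fn// mulr0].
have Winv : invariant_subspace (T_rep tau a eps) W.
  split.
    split=> [f []//||c f g [fk fn] [gk gn]].
      by split=> //; exact: kspan0.
    split; first exact: kspan_lin.
    by move=> j jn; rewrite hvecDE hvecZE fn// gn// mulr0 addr0.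
  move=> g f [fk fn]; apply: (@lin_ext_vanishing _ _ _ (fun j => j < n)) => // i.
  rewrite -leNgt => ni; case: g.
  - by apply: WZ; exact: ketW.
  - by apply: WZ; exact: ketW.
  - by apply/WZ/ketW; rewrite (le_trans ni)// lerDl.
  - have [->|i_neq] := eqVneq i n.
      by rewrite /= an0 scale0r; split=> //; exact: kspan0.
    by apply/WZ/ketW; rewrite lerBrDr lezD1 lt_neqAle eq_sym i_neq.
case: (irr W Winv) => [W0|Wk].
  have : W (ket R n) by exact: ketW.
  by rewrite W0 => /ket_neq0.
have [_ /(_ (n - 1))] : W (ket R (n - 1)) by rewrite Wk; exact: kspan_ket.
by rewrite ketE eqxx ltrBlDr ltrDl => /(_ isT)/eqP; rewrite oner_eq0.
Qed.

End SL2.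

(** * The ladder indexed by the integers *)

Section Ladder.
Variables (R : realType) (tau a' : R[i]).
Implicit Types (k : int) (n : nat) (s t : bool).

Local Notation q := (qpow tau 1).
Local Notation h := (qpow tau (1/2)).

Definition qhalf k : R[i] := qpow tau (k%:~R - 1/2).

Lemma qhalfS k : qhalf (k + 1) = q * qhalf k.
Proof. by rewrite /qhalf -qpowD rmorphD /= addrCA addrA. Qed.

Lemma qhalf_refl k : qhalf (1 - k) = (qhalf k)^-1.
Proof. by rewrite /qhalf -qpowN rmorphB /=; congr qpow; field. Qed.

Lemma qhalf_pred k : qhalf (k - 1) = qhalf k / q.
Proof. by rewrite -[in RHS](subrK 1 k) qhalfS mulrC mulKf ?qpow_neq0. Qed.

Lemma qhalf_neq0 k : qhalf k != 0. Proof. exact: qpow_neq0. Qed.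

Lemma qpow_half_sqr : h ^+ 2 = q.
Proof. by rewrite expr2 -qpowD; congr qpow; field. Qed.

Lemma qhalf_sqr k : qhalf k ^+ 2 = qpow tau (2 * k - 1)%:~R.
Proof. by rewrite expr2 -qpowD; congr qpow; rewrite rmorphB rmorphM /=; field. Qed.

Lemma qpow_int_half k : qpow tau k%:~R = h * qhalf k.
Proof. by rewrite /qhalf -qpowD; congr qpow; field. Qed.

(** The eigenvalue of I1 and the two coefficients of I2 in the formulas for
    [|k>], [k >= 2], with the sign [s] left out and [k] now any integer. *)
Definition ladder_eig k : R[i] := - ((qhalf k + (qhalf k)^-1) / (q - q^-1)).

Definition ladder_up k : R[i] :=
  'i * (qnum tau (a' - k%:~R) / (qhalf k - (qhalf k)^-1)).

Definition ladder_down k : R[i] :=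
  'i * (qnum tau (a' + k%:~R - 1) / (qhalf k - (qhalf k)^-1)).

Lemma ladder_eig_refl k : ladder_eig (1 - k) = ladder_eig k.
Proof. by rewrite /ladder_eig qhalf_refl invrK addrC. Qed.

Lemma ladder_up_refl k : ladder_up (1 - k) = - ladder_down k.
Proof.
rewrite /ladder_up /ladder_down qhalf_refl invrK.
have -> : a' - (1 - k)%:~R = a' + k%:~R - 1 by rewrite rmorphB /=; ring.
by rewrite -[(qhalf k)^-1 - _]opprB invrN !mulrN.
Qed.

Lemma ladder_down_refl k : ladder_down (1 - k) = - ladder_up k.
Proof. by rewrite -[X in ladder_up X](subKr 1) ladder_up_refl opprK. Qed.

(** The ratio between [|- n>] and [|n + 1>]. At [n = 0] it is dictated by the
    diagonal term of I2 at [|1>], which has to equal the lowering coefficient of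
    [|1>] applied to the folded [|0>]; the sign alternates with [n] because the
    reflection exchanges [ladder_up] and [ladder_down] up to a sign. *)
Definition fold_coef t n : R[i] := - 'i * (-1) ^+ t * (-1) ^+ n.

(** The vector [|k>] for every integer [k]; the basis vector [|k>], [k >= 1], is
    [ket R k.-1]. *)
Definition fold_ket t k : hvec R nat :=
  if k is Posz n.+1 then ket R n else fold_coef t `|k|%N *: ket R `|k|%N.

Lemma int_reflect_ind (P : int -> Prop) :
  (forall n : nat, P n.+1) -> (forall n : nat, P (- n%:Z)) -> forall k, P k.
Proof.
move=> Ppos Pneg [[|n]|n]; [exact: (Pneg 0%N)|exact: Ppos|].
by rewrite NegzE; exact: Pneg.
Qed.

Lemma fold_ket_neg t n : fold_ket t (- n%:Z) = fold_coef t n *: ket R n.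
Proof. by case: n. Qed.

(** At [n = 0] the relation between [|0>] and [|1>] is used backwards; this is
    consistent because [fold_coef t 0] squares to [-1]. *)
Lemma fold_ket_refl t n :
  fold_ket t (1 - n%:Z) = - fold_coef t n *: fold_ket t n.
Proof.
case: n => [|n].
  rewrite /= scalerA mulNr -expr2 /fold_coef !exprMn sqrrN sqrCi sqrr_sign.
  by rewrite expr0 expr1n !mulr1 opprK scale1r.
have -> : 1 - n.+1%:Z = - n%:Z by lia.
by rewrite fold_ket_neg /fold_coef exprS mulN1r mulrN opprK.
Qed.

Lemma kspan_fold_ket t k : kspan (fold_ket t k).
Proof.
elim/int_reflect_ind: k => n; first exact: kspan_ket.
by rewrite fold_ket_neg; apply: kspanZ; exact: kspan_ket.
Qed.

Lemma Rh_I1E s t :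
  Rh_rep tau s t a' so3_I1 = diag_op (fun n => (-1) ^+ s * ladder_eig n.+1).
Proof.
congr lin_ext; apply/funext => n; congr (_ *: _).
congr (_ * - (_ / (_ - _))); last by rewrite qpowN.
by rewrite /qhalf -[in RHS]qpowN opprB addrC [1/2 + _]addrC addrC.
Qed.

(** With the folded ket [fold_ket t 0], one formula covers the first basis vector
    and all the others. *)
Definition Rh_I2_col s t n : hvec R nat :=
  (-1) ^+ s *: (ladder_up n.+1 *: fold_ket t n.+2 + ladder_down n.+1 *: fold_ket t n).

Lemma qhalf_natE n : qpow tau (n%:R - 1/2) - qpow tau (- n%:R + 1/2) =
  qhalf n - (qhalf n)^-1.
Proof. by rewrite /qhalf -[in RHS]qpowN opprB [1/2 - _]addrC. Qed.

Lemma Rh_I2E s t : Rh_rep tau s t a' so3_I2 = lin_ext (Rh_I2_col s t).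
Proof.
congr lin_ext; apply/funext => n; congr (_ *: _).
case: n => [|n] /=; last by rewrite !qhalf_natE.
have -> : h - qpow tau (- (1/2)) = qhalf 1 - (qhalf 1)^-1.
  have e : 1%:R - 1/2 = 1/2 :> R[i] by field.
  have e' : - 1%:R + 1/2 = - (1/2) :> R[i] by field.
  by rewrite -(qhalf_natE 1) e e'.
rewrite addrC scalerA; congr (_ *: _ + _ *: _).
rewrite /ladder_down addrK /fold_coef expr0 mulr1.
set X := _ / _; transitivity (- ('i * 'i) * ((-1) ^+ t * X)); last by ring.
by rewrite -expr2 sqrCi opprK mul1r.
Qed.

Lemma Rh_I1_fold s t k :
  Rh_rep tau s t a' so3_I1 (fold_ket t k) =
  ((-1) ^+ s * ladder_eig k) *: fold_ket t k.
Proof.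
rewrite Rh_I1E /diag_op; elim/int_reflect_ind: k => n; first by rewrite lin_ext_ket.
rewrite fold_ket_neg (span_linearZ (@lin_ext_lin _ _ _)) ?lin_ext_ket;
  last exact: kspan_ket.
rewrite !scalerA [in LHS]mulrC -ladder_eig_refl.
by rewrite (_ : 1 - n.+1%:Z = - n%:Z)//; lia.
Qed.

(** The generic formula persists for nonpositive [k], since the reflection
    changes the sign of both coefficients of I2 and exchanges them, and the
    alternating sign in [fold_coef] absorbs this. *)
Lemma Rh_I2_fold s t k :
  Rh_rep tau s t a' so3_I2 (fold_ket t k) =
  (-1) ^+ s *:
    (ladder_up k *: fold_ket t (k + 1) + ladder_down k *: fold_ket t (k - 1)).
Proof.
rewrite Rh_I2E; elim/int_reflect_ind: k => n.
  rewrite [fold_ket t n.+1]/= lin_ext_ket /Rh_I2_col.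
  by rewrite (_ : n.+1%:Z + 1 = n.+2) 1?(_ : n.+1%:Z - 1 = n)//; lia.
rewrite fold_ket_neg (span_linearZ (@lin_ext_lin _ _ _)) ?lin_ext_ket;
  last exact: kspan_ket.
rewrite /Rh_I2_col scalerA mulrC -scalerA; congr (_ *: _).
rewrite addrC scalerDr.
have n1 : 1 - n.+1%:Z = - n%:Z by lia.
rewrite -n1 ladder_up_refl ladder_down_refl n1 [- _ + 1]addrC fold_ket_refl.
rewrite (_ : - n%:Z - 1 = - n.+1%:Z); last by lia.
rewrite fold_ket_neg !scalerA; congr (_ *: _ + _ *: _).
  by rewrite mulrN mulNr opprK mulrC.
by rewrite /fold_coef exprS; ring.
Qed.

End Ladder.

Section LadderIdentities.
Variables (R : realType) (tau a' : R[i]).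
Hypothesis q_not_unity_root : forall n : nat, (0 < n)%N -> cexp tau ^+ n != 1.

Local Notation q := (qpow tau 1).
Local Notation h := (qpow tau (1/2)).
Local Notation A := (qpow tau a').
Local Notation qhalf := (qhalf tau).
Local Notation ladder_eig := (ladder_eig tau).
Local Notation ladder_up := (ladder_up tau a').
Local Notation ladder_down := (ladder_down tau a').

Lemma qhalf_sub_neq0 k : qhalf k - (qhalf k)^-1 != 0.
Proof.
apply/eqP => /subr0_eq hk; have := qhalf_sqr tau k.
rewrite expr2 {1}hk mulVf ?qhalf_neq0// => /esym/(qpow_int_eq1 q_not_unity_root).
by lia.
Qed.

Let qd0 : q - q^-1 != 0 := qdiff_neq0 q_not_unity_root.
Let h0 : h != 0 := qpow_neq0 tau _.

(** Neighbouring eigenvalues satisfy first order relations, which make I3 act on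
    [|k>] like I2, up to the factors [qhalf k] and [(qhalf k)^-1]. *)
Lemma ladder_eig_up k : h * ladder_eig (k + 1) - h^-1 * ladder_eig k = - (h * qhalf k).
Proof.
have x0 := qhalf_neq0 tau k; have d0 := qd0.
rewrite /ladder_eig qhalfS; set d := (q - q^-1) in d0 *.
transitivity (- ((h * (q * qhalf k + (q * qhalf k)^-1)
                  - h^-1 * (qhalf k + (qhalf k)^-1)) / d)); first by ring.
rewrite (_ : _ - _ = h * qhalf k * d) ?mulfK// /d -qpow_half_sqr.
by field; rewrite h0.
Qed.

(** The reflection [k |-> 1 - k] inverts [qhalf] and fixes the eigenvalues, so
    an identity for the upper neighbour yields one for the lower neighbour. *)
Lemma ladder_eig_down k :
  h * ladder_eig (k - 1) - h^-1 * ladder_eig k = - (h / qhalf k).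
Proof.
rewrite -(ladder_eig_refl tau k) -(ladder_eig_refl tau (k - 1)).
by rewrite (_ : 1 - (k - 1) = 1 - k + 1) ?ladder_eig_up ?qhalf_refl//; ring.
Qed.

Lemma ladder_eig_upV k :
  h * ladder_eig k - h^-1 * ladder_eig (k + 1) = - (h * qhalf k)^-1.
Proof.
have x0 := qhalf_neq0 tau k; have d0 := qd0.
rewrite /ladder_eig qhalfS; set d := (q - q^-1) in d0 *.
transitivity (- ((h * (qhalf k + (qhalf k)^-1)
                  - h^-1 * (q * qhalf k + (q * qhalf k)^-1)) / d)); first by ring.
rewrite (_ : _ - _ = (h * qhalf k)^-1 * d) ?mulfK// /d -qpow_half_sqr.
by field; rewrite h0 x0.
Qed.

Lemma ladder_eig_downV k :
  h * ladder_eig k - h^-1 * ladder_eig (k - 1) = - (h / qhalf k)^-1.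
Proof.
rewrite -(ladder_eig_refl tau k) -(ladder_eig_refl tau (k - 1)).
by rewrite (_ : 1 - (k - 1) = 1 - k + 1) ?ladder_eig_upV ?qhalf_refl//; ring.
Qed.

(** The two paths of length 2 from [|k>] back to itself, through [|k + 1>] and
    through [|k - 1>], contribute the diagonal entry of the relation that expresses
    I1 by I2 and I3. *)
Lemma ladder_updown k :
  ladder_up k * ladder_down (k + 1) * ((q * qhalf k)^-1 - q * qhalf k) +
  ladder_down k * ladder_up (k - 1) * (qhalf k / q - q / qhalf k) =
  ladder_eig k.
Proof.
have x0 := qhalf_neq0 tau k; have A0 := qpow_neq0 tau a'.
have := qhalf_sub_neq0 k; have := qhalf_sub_neq0 (k + 1); have := qhalf_sub_neq0 (k - 1).
have i2 : 'i * 'i = -1 :> R[i] by rewrite -expr2 sqrCi.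
rewrite /ladder_up /ladder_down /ladder_eig qhalfS qhalf_pred !qnumE.
rewrite !(qpowD, qpowN) !qpow_int_half qhalfS qhalf_pred.
set x := qhalf k in x0 *; set u := x - x^-1.
set v := q * x - _; set w := x / q - (x / q)^-1.
set a1 := A / (h * x) - _; set b1 := A * (h * (q * x)) / q - _.
set b2 := A * (h * x) / q - _; set a2 := A / (h * (x / q)) - _.
have -> : (q * x)^-1 - q * x = - v by rewrite opprB.
have -> : x / q - q / x = w by rewrite /w invf_div.
have := qd0; set d := q - q^-1 => d0 w0 v0 u0.
(* The factors [v] and [w] cancel, which leaves one common denominator. *)
transitivity ('i * 'i * (a2 * b2 - a1 * b1) / (d * d * u)).
  by field; rewrite u0 v0 w0 d0.
have -> : a2 * b2 - a1 * b1 = (x + x^-1) * u * d.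
  rewrite /a1 /a2 /b1 /b2 /u /d -qpow_half_sqr.
  by field; rewrite h0 x0 A0.
by rewrite i2; field; rewrite d0 x0 u0.
Qed.

End LadderIdentities.

(** * The defining relations *)

Section SO3Relations.
Variables (R : realType) (I : choiceType).

(** The first defining relation is the definition of the third generator, and
    both sides of the other two are linear on the span. *)
Lemma so3_rep_kets (tau : R[i]) (A1 A2 : hvec R I -> hvec R I) :
  let A3 := so3_action tau A1 A2 so3_I3 in
  span_operator A1 -> span_operator A2 ->
  (forall i, qpow tau (1/2) *: A2 (A3 (ket R i)) -
             qpow tau (- (1/2)) *: A3 (A2 (ket R i)) = A1 (ket R i)) ->
  (forall i, qpow tau (1/2) *: A3 (A1 (ket R i)) -
             qpow tau (- (1/2)) *: A1 (A3 (ket R i)) = A2 (ket R i)) ->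
  so3_rep tau (so3_action tau A1 A2).
Proof.
move=> A3 s1 s2 r23 r31.
have s3 : span_operator A3.
  by apply: span_operator_comb; exact: span_operator_comp.
split=> [[]//|f fk]; split=> //.
  by apply: (span_operator_eq (span_operator_comb _ _ (span_operator_comp s2 s3)
    (span_operator_comp s3 s2)) s1).
by apply: (span_operator_eq (span_operator_comb _ _ (span_operator_comp s3 s1)
    (span_operator_comp s1 s3)) s2).
Qed.

End SO3Relations.

Section LadderRepresentation.
Variables (R : realType) (tau a' : R[i]).
Hypothesis q_not_unity_root : forall n : nat, (0 < n)%N -> cexp tau ^+ n != 1.
Variables s t : bool.

Local Notation h := (qpow tau (1/2)).
Local Notation I1 := (Rh_rep tau s t a' so3_I1).
Local Notation I2 := (Rh_rep tau s t a' so3_I2).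
Local Notation I3 := (Rh_rep tau s t a' so3_I3).
Local Notation e := (fold_ket R t).
Local Notation up := (ladder_up tau a').
Local Notation down := (ladder_down tau a').
Local Notation eig := (ladder_eig tau).
Local Notation x := (qhalf tau).

Lemma Rh_span_operator1 : span_operator I1.
Proof. by rewrite Rh_I1E; apply: lin_ext_span => n; apply/kspanZ/kspan_ket. Qed.

Lemma Rh_span_operator2 : span_operator I2.
Proof.
rewrite Rh_I2E; apply: lin_ext_span => n.
by apply/kspanZ/kspanD; apply/kspanZ/kspan_fold_ket.
Qed.

Let I1ZD c u v k l :
  I1 (c *: (u *: e k + v *: e l)) = c *: (u *: I1 (e k) + v *: I1 (e l)).
Proof.
by apply: (span_operatorZD _ _ _ Rh_span_operator1); exact: kspan_fold_ket.
Qed.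

Let I2ZD c u v k l :
  I2 (c *: (u *: e k + v *: e l)) = c *: (u *: I2 (e k) + v *: I2 (e l)).
Proof.
by apply: (span_operatorZD _ _ _ Rh_span_operator2); exact: kspan_fold_ket.
Qed.

Lemma Rh_I3E f : I3 f = h *: I1 (I2 f) - h^-1 *: I2 (I1 f).
Proof. by rewrite -qpowN. Qed.

Lemma Rh_span_operator3 : span_operator I3.
Proof.
rewrite (_ : I3 = fun f => h *: (I1 \o I2) f - h^-1 *: (I2 \o I1) f).
  by apply: span_operator_comb; apply: span_operator_comp;
    by [exact: Rh_span_operator1|exact: Rh_span_operator2].
by apply/funext => f; rewrite Rh_I3E.
Qed.

Let I3ZD c u v k l :
  I3 (c *: (u *: e k + v *: e l)) = c *: (u *: I3 (e k) + v *: I3 (e l)).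
Proof.
by apply: (span_operatorZD _ _ _ Rh_span_operator3); exact: kspan_fold_ket.
Qed.

Let I2Z c k : I2 (c *: e k) = c *: I2 (e k).
Proof. exact/(span_linearZ Rh_span_operator2.2)/kspan_fold_ket. Qed.

Let I3Z c k : I3 (c *: e k) = c *: I3 (e k).
Proof. exact/(span_linearZ Rh_span_operator3.2)/kspan_fold_ket. Qed.

Let sgn2 : (-1) ^+ s * (-1) ^+ s = 1 :> R[i].
Proof. by rewrite -expr2 sqrr_sign. Qed.

Lemma Rh_I3_fold k :
  I3 (e k) = - h *: ((x k * up k) *: e (k + 1) + ((x k)^-1 * down k) *: e (k - 1)).
Proof.
rewrite Rh_I3E Rh_I1_fold I2Z Rh_I2_fold I1ZD !Rh_I1_fold.
apply/funext => j; rewrite !(hvecDE, hvecZE) -scaleNr !(hvecDE, hvecZE).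
have eu := ladder_eig_up q_not_unity_root k.
have ed := ladder_eig_down q_not_unity_root k.
set y := e (k + 1) j; set z := e (k - 1) j.
transitivity ((-1) ^+ s * (-1) ^+ s *
  (up k * (h * eig (k + 1) - h^-1 * eig k) * y +
   down k * (h * eig (k - 1) - h^-1 * eig k) * z)); first by ring.
by rewrite eu ed sgn2; ring.
Qed.

Lemma Rh_relation31 k : h *: I3 (I1 (e k)) - h^-1 *: I1 (I3 (e k)) = I2 (e k).
Proof.
rewrite Rh_I1_fold I3Z Rh_I3_fold I1ZD !Rh_I1_fold Rh_I2_fold.
have h0 := qpow_neq0 tau (1/2); have x0 := qhalf_neq0 tau k.
have eu := ladder_eig_upV q_not_unity_root k.
have ed := ladder_eig_downV q_not_unity_root k.
apply/funext => j; rewrite !(hvecDE, hvecZE) -scaleNr !(hvecDE, hvecZE).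
set y := e (k + 1) j; set z := e (k - 1) j.
transitivity ((-1) ^+ s * (- h *
  (x k * up k * (h * eig k - h^-1 * eig (k + 1)) * y +
   (x k)^-1 * down k * (h * eig k - h^-1 * eig (k - 1)) * z))); first by ring.
by rewrite eu ed; field; rewrite h0 x0.
Qed.

Lemma Rh_relation23 k : h *: I2 (I3 (e k)) - h^-1 *: I3 (I2 (e k)) = I1 (e k).
Proof.
rewrite Rh_I3_fold Rh_I2_fold I2ZD I3ZD !Rh_I3_fold !Rh_I2_fold Rh_I1_fold.
have h0 := qpow_neq0 tau (1/2); have x0 := qhalf_neq0 tau k.
rewrite -(ladder_updown a' q_not_unity_root k).
rewrite addrK subrK qhalfS qhalf_pred -qpow_half_sqr.
apply/funext => j; rewrite !(hvecDE, hvecZE) -scaleNr !(hvecDE, hvecZE).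
by field; rewrite h0 x0.
Qed.

Lemma Rh_so3_rep : so3_rep tau (Rh_rep tau s t a').
Proof.
have -> : Rh_rep tau s t a' = so3_action tau I1 I2 by [].
apply: so3_rep_kets; [exact: Rh_span_operator1|exact: Rh_span_operator2|..] => i.
  by have := Rh_relation23 i.+1; rewrite -qpowN.
by have := Rh_relation31 i.+1; rewrite -qpowN.
Qed.

End LadderRepresentation.

(** * Irreducibility and nonequivalence *)

Lemma add_inv_eq (F : fieldType) (x y : F) :
  x != 0 -> y != 0 -> x + x^-1 = y + y^-1 -> x = y \/ x = y^-1.
Proof.
move=> x0 y0 xy; have : (x - y) * (x - y^-1) = 0.
  transitivity (x * (x + x^-1) - x * (y + y^-1)); last by rewrite xy subrr.
  by field; rewrite x0 y0.
by move/eqP; rewrite mulf_eq0 !subr_eq0 => /orP[] /eqP ->; [left|right].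
Qed.

Section LadderIrreducibility.
Variables (R : realType) (tau a' : R[i]).
Hypothesis q_not_unity_root : forall n : nat, (0 < n)%N -> cexp tau ^+ n != 1.
Hypothesis qnum_a'_neq0 : forall n : int, qnum tau (a' + n%:~R) != 0.
Implicit Types (n m : nat) (s t : bool).

Lemma qpow_int_inj (k l : int) : qpow tau k%:~R = qpow tau l%:~R -> k = l.
Proof.
move=> kl; apply: subr0_eq; apply: (qpow_int_eq1 q_not_unity_root).
by rewrite rmorphB /= qpowD qpowN kl divff ?qpow_neq0.
Qed.

Lemma qhalf_sign_inj (b : bool) (k l : int) :
  qhalf tau k = (-1) ^+ b * qhalf tau l -> k = l /\ b = false.
Proof.
move=> kl; have kl' : k = l.
  have : qhalf tau k ^+ 2 = qhalf tau l ^+ 2 by rewrite kl exprMn sqrr_sign mul1r.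
  by rewrite !qhalf_sqr => /qpow_int_inj; lia.
split=> //; case: b kl => //; rewrite kl' expr1 mulN1r => /eqP.
rewrite -addr_eq0 -mulr2n -mulr_natr mulf_eq0 pnatr_eq0 orbF.
by rewrite (negPf (qhalf_neq0 _ _)).
Qed.

(** [x + x^-1] determines [x] up to inversion, and [(qhalf m.+1)^-1] is [qhalf]
    at the nonpositive index [- m]. *)
Lemma ladder_eig_sign_inj s s' n m :
  (-1) ^+ s * ladder_eig tau n.+1 = (-1) ^+ s' * ladder_eig tau m.+1 ->
  s = s' /\ n = m.
Proof.
have d0 := qdiff_neq0 q_not_unity_root.
have y0 := qhalf_neq0 tau m.+1; have x0 := qhalf_neq0 tau n.+1.
pose c : R[i] := (-1) ^+ (s (+) s').
have c0 : c != 0 by rewrite signr_eq0.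
have cV : c^-1 = c by rewrite invr_sign.
rewrite /ladder_eig !mulrN => /oppr_inj; rewrite !mulrA => /(divIf d0) snm.
have : qhalf tau n.+1 + (qhalf tau n.+1)^-1 =
       c * qhalf tau m.+1 + (c * qhalf tau m.+1)^-1.
  rewrite [(c * _)^-1]invfM cV -mulrDr /c signr_addb -mulrA -snm.
  by rewrite mulrA -expr2 sqrr_sign mul1r.
move=> /(add_inv_eq x0 (mulf_neq0 c0 y0))[|].
  move=> /qhalf_sign_inj[nm ss']; split; last by case: nm.
  by case: s s' ss' {c c0 cV snm} => [] [].
rewrite [(c * _)^-1]invfM cV -qhalf_refl => /qhalf_sign_inj[]; lia.
Qed.

Lemma ladder_eig_inj s : injective (fun n => (-1) ^+ s * ladder_eig tau n.+1).
Proof. by move=> n m /ladder_eig_sign_inj[]. Qed.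

Lemma ladder_up_neq0 k : ladder_up tau a' k != 0.
Proof.
apply: mulf_neq0; first exact: neq0Ci.
apply: mulf_neq0; last by rewrite invr_eq0; exact: qhalf_sub_neq0.
by have := qnum_a'_neq0 (- k); rewrite mulrNz.
Qed.

Lemma ladder_down_neq0 k : ladder_down tau a' k != 0.
Proof.
rewrite (_ : k = 1 - (1 - k)) ?ladder_down_refl ?oppr_eq0 ?ladder_up_neq0//.
by rewrite opprB addrC subrK.
Qed.

(** One basis vector lies in a nonzero invariant subspace because I1 has simple
    spectrum; I2 then yields its neighbours, whose coefficients are nonzero. *)
Lemma Rh_irreducible s t : irreducible (Rh_rep tau s t a').
Proof.
split=> [|W [Wsub Winv]]; first exact: (kspan_neq0 0%N).
have s0 : (-1) ^+ s != 0 :> R[i] by rewrite signr_eq0.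
have [[f [n [Wf fn]]]|W0] := pselect (exists f n, W f /\ f n <> 0); last first.
  left; apply/seteqP; split=> [f Wf|f ->]; last by case: Wsub.
  apply/funext => n; apply: contrapT => fn; apply: W0; by exists f, n.
have Wket g m : W g -> g m <> 0 -> W (ket R m).
  apply: invariant_ket Wsub _ => //; first exact: (@ladder_eig_inj s).
  by move=> f'; rewrite -(Rh_I1E tau a' s t); exact: Winv.
have I2ket m : Rh_rep tau s t a' so3_I2 (ket R m) = Rh_I2_col tau a' s t m.
  by rewrite Rh_I2E lin_ext_ket.
have Wdown m : W (ket R m.+1) -> W (ket R m).
  move=> /(Winv so3_I2)/Wket; apply; rewrite I2ket /Rh_I2_col.
  rewrite !(hvecDE, hvecZE) /fold_ket !ketE eqxx (ltn_eqF (leqnSn m.+1)).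
  rewrite mulr0 add0r mulr1.
  by apply/eqP; rewrite mulf_neq0// ladder_down_neq0.
have Wup m : W (ket R m) -> W (ket R m.+1).
  move=> /(Winv so3_I2)/Wket; apply; rewrite I2ket /Rh_I2_col.
  have em : fold_ket R t m m.+1 = 0.
    by case: m => [|m]; rewrite /fold_ket ?hvecZE ketE ?mulr0// gtn_eqF.
  rewrite !(hvecDE, hvecZE) em /fold_ket ketE eqxx mulr0 addr0 mulr1.
  by apply/eqP; rewrite mulf_neq0// ladder_up_neq0.
right; apply: subspace_kspan => // m.
have {fn} W0 : W (ket R 0%N).
  by elim: n {fn} (Wket f n Wf fn) => // n IHn /Wdown/IHn.
by elim: m => // m /Wup.
Qed.

(** The eigenvalues of I1 determine [s]. An intertwining operator between two
    representations with the same [s] rescales each basis vector, so it preserves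
    the diagonal entry of I2 at the first one, which is proportional to
    [(-1) ^+ t] with a nonzero factor. *)
Lemma Rh_not_equivalent s t s' t' : (s, t) <> (s', t') ->
  ~ equivalent (Rh_rep tau s t a') (Rh_rep tau s' t' a').
Proof.
move=> st.
move=> /(irreducible_equivalent 0%N 0%N (Rh_irreducible s t) (Rh_irreducible s' t')).
move=> [A intA].
have E := Rh_I1E tau a' s t; have E' := Rh_I1E tau a' s' t'.
have [j [/ladder_eig_sign_inj[ss' _] _]] := intertwiner_eigenvalue E E' intA 0%N.
subst s'.
have inj := @ladder_eig_inj s.
have A0 := intertwiner_ket E E' intA inj (erefl : _ 0%N = _ 0%N).
have A1 := intertwiner_ket E E' intA inj (erefl : _ 1%N = _ 1%N).
have [Alin Ak Ainj Aint] := intA.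
have I2ket0 u : Rh_rep tau s u a' so3_I2 (ket R 0%N) = (-1) ^+ s *:
    (ladder_up tau a' 1 *: ket R 1%N +
     (ladder_down tau a' 1 * fold_coef R u 0) *: ket R 0%N).
  by rewrite Rh_I2E lin_ext_ket -scalerA.
have c0 : (A (ket R 0%N) 0%N : R[i]) != 0.
  apply/eqP => c0; apply: (@ket_neq0 R nat 0%N); apply: Ainj; first exact: kspan_ket.
  by rewrite A0 c0 scale0r.
have := Aint so3_I2 _ (kspan_ket R 0%N).
rewrite A0 (span_linearZ (Rh_span_operator2 tau a' s t').2); last exact: kspan_ket.
rewrite !I2ket0 (span_operatorZD _ _ _ (conj Ak Alin)); try exact: kspan_ket.
move=> /(congr1 (fun f => f 0%N)); rewrite A1 !(hvecDE, hvecZE) !ketE eqxx.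
rewrite !mulr0 !add0r mulr1 mulrA [_ * A _ _]mulrC => /(mulfI c0).
have s0 : (-1) ^+ s != 0 :> R[i] by rewrite signr_eq0.
move=> /(mulfI s0)/(mulfI (ladder_down_neq0 1)).
rewrite /fold_coef expr0 !mulr1.
have i0 : - 'i != 0 :> R[i] by rewrite oppr_eq0 neq0Ci.
by move=> /(mulfI i0)/signr_inj tt'; apply: st; rewrite tt'.
Qed.

(** The factor ['i] turns the difference in the q-number into a sum, which gives
    the eigenvalues the same shape as those of [Rh_rep]. *)
Lemma Rb_I1E b eps : Rb_rep tau b eps so3_I1 = diag_op (fun n : int =>
  let z := 'i * qpow tau (n%:~R + eps) in
  (z + z^-1) / (qpow tau 1 - (qpow tau 1)^-1)).
Proof.
congr lin_ext; apply/funext => n; congr (_ *: _); rewrite qnumE /=.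
by rewrite [in RHS]invfM invCi mulNr mulrA -mulrBr.
Qed.

(** A common eigenvalue makes [z 0 ^+ 2] an odd power of [q], and then the
    nontrivial shift by [- M] inverts [z 0]: the eigenvalue is not simple. *)
Lemma Rb_Rh_not_equivalent b eps s t : irreducible (Rb_rep tau b eps) ->
  ~ equivalent (Rb_rep tau b eps) (Rh_rep tau s t a').
Proof.
move=> irr /(irreducible_equivalent 0 0%N irr (Rh_irreducible s t))[A intA].
have E := Rb_I1E b eps; have E' := Rh_I1E tau a' s t.
have inj := intertwiner_injective E E' intA (@ladder_eig_inj s).
have [n [/= eig _]] := intertwiner_eigenvalue E E' intA 0.
pose z (k : int) : R[i] := 'i * qpow tau (k%:~R + eps).
have z0 k : z k != 0 by rewrite mulf_neq0 ?neq0Ci ?qpow_neq0.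
have zD k l : z (k + l) = z k * qpow tau l%:~R.
  by rewrite /z rmorphD /= addrAC qpowD mulrA.
have d0 := qdiff_neq0 q_not_unity_root.
have [M M0 zM] : exists2 M : int, M != 0 & z 0 ^+ 2 = qpow tau M%:~R.
  have x0 := qhalf_neq0 tau n.+1; set x := qhalf tau n.+1 in x0.
  have c0 : (-1) ^+ (~~ s) != 0 :> R[i] by rewrite signr_eq0.
  have : z 0 + (z 0)^-1 = (-1) ^+ (~~ s) * x + ((-1) ^+ (~~ s) * x)^-1.
    apply: (divIf d0); rewrite -[LHS]eig /ladder_eig [(_ ^+ _ * _)^-1]invfM.
    by rewrite invr_sign -mulrDr signrN mulrN !mulNr mulrA.
  move=> /(add_inv_eq (z0 0) (mulf_neq0 c0 x0))[] ->.
    exists (2 * n.+1%:Z - 1); first by lia.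
    by rewrite exprMn sqrr_sign mul1r qhalf_sqr.
  exists (2 * (1 - n.+1%:Z) - 1); first by lia.
  by rewrite invfM invr_sign exprMn sqrr_sign mul1r -qhalf_refl qhalf_sqr.
have zNM : z (- M) = (z 0)^-1.
  apply: (mulfI (z0 0)); rewrite divff// -[- M]add0r zD mulrA -expr2 zM.
  by rewrite mulrNz qpowMN.
have := inj (- M) 0; rewrite /= -!/(z _) zNM invrK addrC => /(_ erefl)/eqP.
by rewrite oppr_eq0 (negPf M0).
Qed.

End LadderIrreducibility.

Theorem theorem2 (R : realType) (tau a : R[i])
  (q_not_unity_root : forall n : nat, (0 < n)%N -> cexp tau ^+ n != 1)
  (T_plus_irr : sl2_irrep tau (T_rep tau a (ipi2tau tau + 1/2)))
  (T_minus_irr : sl2_irrep tau (T_rep tau a (- ipi2tau tau + 1/2))) :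
  let a' := a + ipi2tau tau + 1/2 in
  [/\ forall s t : bool, so3_irrep tau (Rh_rep tau s t a'),
      forall s t s' t' : bool, (s, t) <> (s', t') ->
        ~ equivalent (Rh_rep tau s t a') (Rh_rep tau s' t' a')
    & forall b eps : R[i],
        0 <= complex.Re eps < 1 ->
        eps <> ipi2tau tau -> eps <> - ipi2tau tau ->
        eps <> ipi2tau tau + 1/2 -> eps <> - ipi2tau tau + 1/2 ->
        so3_irrep tau (Rb_rep tau b eps) ->
        forall s t : bool,
          ~ equivalent (Rb_rep tau b eps) (Rh_rep tau s t a')].
Proof.
move=> a'.
have a'n (n : int) : qnum tau (a' + n%:~R) != 0.
  rewrite /a' -addrA -addrA [1/2 + _]addrC [ipi2tau tau + _]addrCA.
  exact: T_rep_irreducible_qnum T_plus_irr.2.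
split=> [s t|s t s' t' st|b eps _ _ _ _ _ [_ irr] s t].
- by split; [exact: Rh_so3_rep|exact: Rh_irreducible].
- exact: Rh_not_equivalent.
- exact: Rb_Rh_not_equivalent.
Qed.
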